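(* Let $p,q\in\mathbb{C}[z_1,\dots,z_d]$ and assume $p$ has no zeros in $\mathbb{H}^d$. If $f=q/p$ is bounded in $\mathbb{H}^d$, then the directional derivative $$D_vf(0)=\lim_{r\to0^+}\frac{f(rv)-f^*(0)}{r}$$ exists for every $v\in\mathbb{H}^d$.
   Context: $\mathbb{H}$ is the open upper half plane. $f^*(0)$ denotes the non-tangential limit of $f$ at $0$: the common limit of $f(z)$ as $z\to0$ within each region $AR_c=\{z\in\mathbb{H}^d: 1/c\le a/b\le c\text{ for all }a,b\in\{|z_1|,\dots,|z_d|,\operatorname{Im}z_1,\dots,\operatorname{Im}z_d\}\}$, $c\ge1$. It is known that this limit exists for every bounded rational analytic function on $\mathbb{H}^d$. *)

(* Defs.v *)
From HB Require Import structures.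
From mathcomp Require Import all_boot all_order all_algebra.
From mathcomp Require Import all_classical all_reals all_analysis.
From mathcomp Require Import complex.
(* Not imported: the notations of mpoly clash with those of the analysis
   library. *)
From mathcomp Require mpoly.

Set Implicit Arguments.
Unset Strict Implicit.
Unset Printing Implicit Defensive.

Import Order.TTheory GRing.Theory Num.Theory.
Import numFieldNormedType.Exports.

Local Open Scope classical_set_scope.
Local Open Scope ring_scope.
Local Open Scope complex_scope.

(* The standard topology of the complex numbers; the library only attaches it
   to the alias R[i]^o. *)
#[non_forgetful_inheritance]
HB.instance Definition _ (R : rcfType) := NormedModule.copy R[i] R[i]^o.

Section Defs.
Context {R : realType} {d : nat}.
Implicit Types (z : 'rV[R[i]]_d) (f : 'rV[R[i]]_d -> R[i]) (l : R[i]) (c : R).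

Definition upper_half_space : set 'rV[R[i]]_d :=
  [set z | forall j, 0 < complex.Im (z 0 j)].

Definition ratfun (q p : mpoly.mpoly d R[i]) : 'rV[R[i]]_d -> R[i] :=
  fun z => mpoly.meval (z 0) q / mpoly.meval (z 0) p.

Definition moduli_and_heights z : set R :=
  [set a | exists j, a = ComplexField.Normc.normc (z 0 j) \/
                     a = complex.Im (z 0 j)].

Definition approach_region c : set 'rV[R[i]]_d :=
  [set z | upper_half_space z /\
    forall a b, moduli_and_heights z a -> moduli_and_heights z b ->
      c^-1 <= a / b <= c].

Definition is_nt_limit f l : Prop :=
  forall c, 1 <= c -> f @ within (approach_region c) (nbhs (0 : 'rV[R[i]]_d)) --> l.

(* The non-tangential limit of f at 0, written f^*(0). Like the library's lim,
   it is a total operator, with an arbitrary value when no limit exists. *)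
Definition nt_lim f : R[i] := get (is_nt_limit f).

Lemma approach_region_proper c : 1 <= c ->
  ProperFilter (within (approach_region c) (nbhs (0 : 'rV[R[i]]_d))).
Proof.
move=> c1; apply: Build_ProperFilter_ex => /= A /nbhs_ballP[e /= e0 He].
have e'0 : (0 : R[i]) < e / 2%:R by rewrite divr_gt0 ?ltr0n.
have eR : e / 2%:R = (complex.Re (e / 2%:R))%:C.
  by rewrite RRe_real// ger0_real// ltW.
set t := complex.Re (e / 2%:R) in eR.
have t0 : 0 < t by move: e'0; rewrite eR ltcR.
set z : 'rV[R[i]]_d := const_mx (0 +i* t).
have normt : ComplexField.Normc.normc (0 +i* t) = t.
  by rewrite /= expr0n/= add0r sqrtr_sqr gtr0_norm.
have zE a : moduli_and_heights z a -> a = t.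
  by case=> j; rewrite /z !mxE normt => -[] ->.
exists z; apply: He.
  split=> // i j; rewrite /z !mxE -ball_normE /ball_ /= sub0r normrN.
  have -> : `|0 +i* t| = (ComplexField.Normc.normc (0 +i* t))%:C by [].
  by rewrite normt -eR ltr_pdivrMr ?ltr0n// mulr_natr mulr2n ltrDl.
split=> [j|a b /zE -> /zE ->]; first by rewrite /z mxE.
by rewrite divff ?gt_eqF// c1 andbT invf_le1 ?(lt_le_trans _ c1).
Qed.

Lemma nt_limE f l : is_nt_limit f l -> nt_lim f = l.
Proof.
move=> fl; rewrite /nt_lim; case: xgetP => [_ -> /(_ 1 (lexx 1)) h|/(_ l)//].
have := approach_region_proper (lexx 1) => ?.
exact: (cvg_unique (@norm_hausdorff _ R[i]) h (fl 1 (lexx 1))).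
Qed.

End Defs.

(* Main.v *)
Require Import Defs.
From mathcomp Require Import all_boot all_order all_algebra.
From mathcomp Require Import all_classical all_reals all_analysis.
From mathcomp Require Import complex ring.
From mathcomp Require mpoly.
Import Order.TTheory GRing.Theory Num.Theory numFieldNormedType.Exports.

Set Implicit Arguments.
Unset Strict Implicit.
Unset Printing Implicit Defensive.

Local Open Scope ring_scope.

(** A polynomial without zeros in the upper half space satisfies a Harnack
    inequality: restricted to a complex line through [z], it has no zero in a
    disk around [z] whose radius is the distance of [z] to the boundary, so
    factoring over its roots bounds [|p(w)|] by a constant times [|p(z)|]. Let
    [M] be the lowest degree of a monomial of [p], and [p_M], [q_M] the
    homogeneous parts of degree [M]. Comparing [p(rw)] and [p(rz)] as [r -> 0]
    shows that [p_M] has no zeros in the half space (a Hurwitz theorem), and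
    boundedness of [q/p] shows that [q] has no terms of degree below [M] and
    [|q_M| <= K |p_M|] on the half space. On the complex line through two
    positive vectors this domination holds everywhere, so [q_M/p_M] is a
    constant [c] there, and [q_M = c p_M] identically. Thus [q - c p] vanishes to
    order [M + 1] at [0], while the Harnack inequality bounds [|p|] below by a
    multiple of [|z|^M] in the approach regions: [c] is the nontangential limit,
    and on a ray [(f(rv) - c)/r] is a rational function of [r] without pole at
    [0]. *)

(** * Growth and vanishing of one-variable polynomials over a closed field, without topology *)

Section Univariate.
Context {C : numClosedFieldType}.
Implicit Types (A B : {poly C}) (D K t : C).

Lemma le0_of_le_small (a D : C) : a \is Num.real -> 0 <= D ->
  (forall t, 0 < t < 1 -> a <= D * t) -> a <= 0.
Proof.
move=> ar D0 h; rewrite real_leNgt ?real0//; apply/negP => a0.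
have aD : 0 < a + D + 1 by rewrite addr_gt0// ltr_wpDr.
(* At this test value the hypothesis would give [a + D + 1 <= D]. *)
have t01 : 0 < a / (a + D + 1) < 1.
  by rewrite divr_gt0//= ltr_pdivrMr// mul1r -addrA ltrDl ltr_wpDl.
have := h _ t01; rewrite mulrCA -{1}[a]mulr1 ler_pM2l// ler_pdivlMr// mul1r.
by rewrite real_leNgt ?ger0_real// ?ltW// addrAC ltrDr ltr_wpDr.
Qed.

Lemma horner_bounded A :
  exists2 D, 0 <= D & forall h : C, `|h| <= 1 -> `|A.[h]| <= D.
Proof.
exists (\sum_(i < size A) `|A`_i|); first exact: sumr_ge0.
move=> h h1; rewrite horner_coef (le_trans (ler_norm_sum _ _ _))//.
apply: ler_sum => i _; rewrite normrM normrX -[leRHS]mulr1.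
by rewrite ler_wpM2l// exprn_ile1.
Qed.

Lemma low_coef0_drop A k : (forall j, (j < k)%N -> A`_j = 0) ->
  A = drop_poly k A * 'X^k.
Proof.
move=> h; rewrite -[LHS](poly_take_drop k).
suff -> : take_poly k A = 0 by rewrite add0r.
by apply/polyP => i; rewrite coef_take_poly coef0; case: ltnP => // /h.
Qed.

Lemma horner_dist0 A : exists2 D, 0 <= D &
  forall h : C, `|h| <= 1 -> `|A.[h] - A.[0]| <= D * `|h|.
Proof.
have [D D0 hD] := horner_bounded (drop_poly 1 (A - A.[0]%:P)).
exists D => // h h1.
have -> : A.[h] - A.[0] = (A - A.[0]%:P).[h] by rewrite !hornerE.
rewrite (@low_coef0_drop (A - A.[0]%:P) 1); last first.
  by case=> // _; rewrite -horner_coef0 !hornerE subrr.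
by rewrite hornerM hornerXn normrM expr1 ler_wpM2r ?hD.
Qed.

(** Passage to the limit [t -> 0]: both values move by [O(t)], so the excess of [|A(0)|] over
    [K |B(0)|] is at most [(D + K * E) * t] for every small [t]. *)
Lemma norm_horner0_le A B K : 0 <= K ->
  (forall t, 0 < t < 1 -> `|A.[t]| <= K * `|B.[t]|) -> `|A.[0]| <= K * `|B.[0]|.
Proof.
move=> K0 h; have [D D0 hD] := horner_dist0 A; have [E E0 hE] := horner_dist0 B.
rewrite -subr_le0; apply: (@le0_of_le_small _ (D + K * E)).
- by rewrite rpredB// ?rpredM// ?normr_real// ger0_real.
- by rewrite addr_ge0// mulr_ge0.
move=> t t01; have /andP[t0 t1] := t01.
have nt : `|t| = t by rewrite gtr0_norm.
have := hD t; have := hE t; rewrite nt (ltW t1) => /(_ isT) hEt /(_ isT) hDt.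
rewrite lerBlDl; apply: (@le_trans _ _ (`|A.[t]| + D * t)).
  by rewrite -lerBlDl (le_trans (lerB_dist _ _))// distrC.
rewrite mulrDl [leRHS]addrCA [leLHS]addrC lerD2l -mulrA -mulrDr.
apply: le_trans (h _ t01) _; rewrite ler_wpM2l// -lerBlDr.
by rewrite lerBlDr -lerBlDl (le_trans (lerB_dist _ _)).
Qed.

Lemma low_coef0_of_bound A D k : 0 <= D ->
  (forall t, 0 < t < 1 -> `|A.[t]| <= D * t ^+ k) ->
  forall j, (j < k)%N -> A`_j = 0.
Proof.
move=> D0; elim: k => // k IH h.
have hk j : (j < k)%N -> A`_j = 0.
  apply: IH => t t01; have /andP[t0 t1] := t01.
  by rewrite (le_trans (h t t01))// ler_wpM2l// exprS ler_piMl ?exprn_ge0 // ltW.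
move=> j; rewrite ltnS leq_eqVlt => /predU1P[->|/hk//].
have -> : A`_k = (drop_poly k A).[0] by rewrite horner_coef0 coef_drop_poly.
apply/eqP; rewrite -normr_le0.
(* The quotient of [A] by ['X^k] is dominated by [D * t], which vanishes at [0]. *)
suff : `|(drop_poly k A).[0]| <= D * `|'X.[0]| by rewrite hornerX normr0 mulr0.
apply: norm_horner0_le => // t t01; have /andP[t0 t1] := t01.
rewrite hornerX [`|t|]gtr0_norm// -(ler_pM2r (exprn_gt0 k t0)).
have <- : `|A.[t]| = `|(drop_poly k A).[t]| * t ^+ k.
  by rewrite {1}(low_coef0_drop hk) hornerM hornerXn normrM normrX (gtr0_norm t0).
by rewrite -mulrA -exprS h.
Qed.

Lemma poly_eq0_of_unit_interval A : (forall t, 0 < t < 1 -> A.[t] = 0) -> A = 0.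
Proof.
move=> h; apply/polyP => i; rewrite coef0.
apply: (@low_coef0_of_bound A 0 i.+1) => // t t01.
by rewrite mul0r normr_le0 h.
Qed.

Lemma horner_line A (x u t : C) : (A \Po (x%:P + u *: 'X)).[t] = A.[x + u * t].
Proof. by rewrite horner_comp !hornerE. Qed.

Lemma norm_horner_le A B K (x u : C) : 0 <= K ->
  (forall t, 0 < t < 1 -> `|A.[x + u * t]| <= K * `|B.[x + u * t]|) ->
  `|A.[x]| <= K * `|B.[x]|.
Proof.
move=> K0 h; rewrite -[x]addr0 -(mulr0 u) -!horner_line.
by apply: norm_horner0_le => // t t01; rewrite !horner_line h.
Qed.

(** A form of Liouville's theorem. Each root of [B] is a root of [A]; cancelling a common linear
    factor keeps the domination, so induction on the size of [B] leads to a constant [B]. *)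
Lemma colinear_of_norm_le A B K : 0 <= K ->
  (forall s : C, `|A.[s]| <= K * `|B.[s]|) -> exists c, A = c *: B.
Proof.
move=> K0; elim: {B}_.+1 {-2}B (ltnSn (size B)) A => // n IH B sB A h.
have [B0|B0] := eqVneq B 0.
  exists 0; rewrite scale0r; apply: poly_eq0_of_unit_interval => t _.
  by apply/eqP; rewrite -normr_le0 (le_trans (h t))// B0 horner0 normr0 mulr0.
have [sB1|/closed_rootP[r rB]] := boolP (size B == 1).
  have [b b0 Bb] := size_poly1P _ sB1.
  have [sA|sA] := leqP (size A) 1.
    by exists (A`_0 / b); rewrite Bb -mul_polyC -polyCM divfK// -size1_polyC.
  (* A nonconstant [A] would take the value [K * |b| + 1], above its bound. *)
  have /closed_rootP[s] : size (A - (K * `|b| + 1)%:P) != 1.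
    by rewrite size_polyDl ?gtn_eqF// size_polyN (leq_ltn_trans (size_polyC_leq1 _)).
  rewrite /root !hornerE subr_eq0 => /eqP As; have := h s.
  rewrite As Bb hornerC ger0_norm ?addr_ge0 ?mulr_ge0//.
  by rewrite gerDl ler10.
have rA : root A r.
  by rewrite /root -normr_le0 (le_trans (h r))// (eqP rB) normr0 mulr0.
have [/factor_theorem[A' EA] /factor_theorem[B' EB]] := (rA, rB).
have [|s|c Ec] := IH B' _ A'.
- move: sB; rewrite EB size_Mmonic ?monicXsubC//; last first.
    by apply: contraNneq B0 => B'0; rewrite EB B'0 mul0r.
  by rewrite size_XsubC addn2.
- have off_root x : x != r -> `|A'.[x]| <= K * `|B'.[x]|.
    move=> xr; have x0 : 0 < `|x - r| by rewrite normr_gt0 subr_eq0.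
    by rewrite -(ler_pM2r x0) -mulrA -!normrM -hornerXsubC -!hornerM -EA -EB.
  have [->|/off_root//] := eqVneq s r.
  (* At the cancelled root, the domination is recovered as a limit along [r + t]. *)
  apply: (@norm_horner_le _ _ _ r 1) => // t /andP[t0 _]; apply: off_root.
  by rewrite mul1r -subr_eq0 addrAC subrr add0r gt_eqF.
by exists c; rewrite EA Ec EB scalerAl.
Qed.

(** Every root [x] satisfies [1 <= |x| * L], so [|1 - x| <= 1 + |x| <= (1 + L) * |x|]; the product
    over the at most [n] roots gives the bound. *)
Lemma norm_horner1_le A n L : 0 < L -> (size A <= n.+1)%N ->
  (forall s : C, `|s| * L < 1 -> A.[s] != 0) -> `|A.[1]| <= (1 + L) ^+ n * `|A.[0]|.
Proof.
move=> L0 sA nz; have [r Er] := closed_field_poly_normal A.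
have A0 : A != 0.
  apply: contraTneq (nz 0 _) => [->|]; first by rewrite horner0 eqxx.
  by rewrite normr0 mul0r ltr01.
have lA0 : lead_coef A != 0 by rewrite lead_coef_eq0.
have sr : (size r <= n)%N.
  by move: sA; rewrite Er size_scale// size_prod_XsubC.
have L1 : 1 <= 1 + L by rewrite lerDl ltW.
apply: (@le_trans _ _ ((1 + L) ^+ size r * `|A.[0]|)); last first.
  by rewrite ler_wpM2r// ler_weXn2l.
have hr x : x \in r -> 1 <= `|x| * L.
  move=> xr; rewrite real_leNgt ?real1 ?ger0_real ?mulr_ge0// ?(ltW L0)//.
  apply/negP => /nz/negP; apply; rewrite Er hornerZ horner_prod mulf_eq0.
  by apply/orP; right; rewrite (big_rem x)//= hornerXsubC subrr mul0r.
rewrite Er !hornerZ !normrM mulrCA ler_wpM2l// !horner_prod !normr_prod.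
elim: (r) hr => [|x s IH] hr; first by rewrite !big_nil expr0 mulr1.
rewrite !big_cons /= exprS mulrACA; apply: ler_pM; rewrite ?prodr_ge0//; last first.
  by apply: IH => y ys; rewrite hr// inE ys orbT.
rewrite !hornerXsubC sub0r normrN mulrDl mul1r.
by rewrite (le_trans (ler_normB _ _))// normr1 addrC lerD2l mulrC hr// mem_head.
Qed.

Lemma horner0_drop A k : (drop_poly k A).[0] = A`_k.
Proof. by rewrite horner_coef0 coef_drop_poly. Qed.

(** The domination makes [A] of order [t ^+ M]; after division of both sides by [t ^+ M], the limit
    at [0] compares the coefficients. *)
Lemma coef_le_of_norm_le A B K M : 0 <= K -> (forall j, (j < M)%N -> B`_j = 0) ->
  (forall t, 0 < t < 1 -> `|A.[t]| <= K * `|B.[t]|) ->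
  (forall j, (j < M)%N -> A`_j = 0) /\ `|A`_M| <= K * `|B`_M|.
Proof.
move=> K0 B0 h; have [D D0 hD] := horner_bounded (drop_poly M B).
have nB t : 0 < t -> `|B.[t]| = `|(drop_poly M B).[t]| * t ^+ M.
  by move=> t0; rewrite {1}(low_coef0_drop B0) hornerM hornerXn normrM normrX (gtr0_norm t0).
have A0 : forall j, (j < M)%N -> A`_j = 0.
  apply: (@low_coef0_of_bound _ (K * D)); first exact: mulr_ge0.
  move=> t t01; have /andP[t0 t1] := t01; rewrite (le_trans (h t t01))// nB//.
  rewrite -mulrA ler_wpM2l// ler_wpM2r ?exprn_ge0 ?(ltW t0)// hD//.
  by rewrite gtr0_norm// ltW.
split=> //; rewrite -!horner0_drop; apply: norm_horner0_le => // t t01.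
have /andP[t0 t1] := t01; rewrite -(ler_pM2r (exprn_gt0 M t0)) -mulrA -nB//.
have <- : `|A.[t]| = `|(drop_poly M A).[t]| * t ^+ M; last exact: h.
by rewrite {1}(low_coef0_drop A0) hornerM hornerXn normrM normrX (gtr0_norm t0).
Qed.

Lemma norm_horner_lower_bound A : A.[0] != 0 -> exists2 e, 0 < e &
  exists2 T0, 0 < T0 < 1 & forall t, 0 < t < T0 -> e <= `|A.[t]|.
Proof.
move=> A0; have a0 : 0 < `|A.[0]| / 2 by rewrite divr_gt0// normr_gt0.
have [D D0 hD] := horner_dist0 A; exists (`|A.[0]| / 2) => //.
have s0 : 0 < 1 + D + `|A.[0]| / 2 by rewrite ltr_wpDl ?addr_ge0.
(* Below this threshold [D * t] is at most half of [|A(0)|]; the extra summands in the denominator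
   keep it below [1]. *)
exists (`|A.[0]| / 2 / (1 + D + `|A.[0]| / 2)).
  by rewrite divr_gt0//= ltr_pdivrMr// mul1r ltrDr ltr_wpDr.
move=> t /andP[t0]; rewrite ltr_pdivlMr// => tT.
have t1 : t <= 1.
  rewrite real_leNgt ?real1 ?gtr0_real//; apply/negP => /ltW t1.
  have := lt_le_trans tT (ler_peMl (ltW a0) t1).
  by rewrite ltr_pM2l// => /lt_geF; rewrite lerDr addr_ge0.
have := hD t; rewrite gtr0_norm// => /(_ t1).
rewrite distrC => /(le_trans (lerB_dist _ _)); rewrite lerBlDl -lerBlDr.
apply: le_trans; rewrite {2}[`|A.[0]|]splitr lerBrDr lerD2l.
rewrite (le_trans _ (ltW tT))// [D * t]mulrC ler_wpM2l ?(ltW t0)//.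
by rewrite addrAC ler_wpDl// addr_ge0// ltW.
Qed.

Lemma horner_ratio_lipschitz A B : A.[0] != 0 -> exists2 D, 0 <= D &
  exists2 T0, 0 < T0 & forall t, 0 < t < T0 ->
    `|B.[t] / A.[t] - B.[0] / A.[0]| <= D * t.
Proof.
move=> A0; have [e e0 [T0 /andP[T00 T01] hT]] := norm_horner_lower_bound A0.
(* This is the numerator of the difference of the two ratios; it vanishes at [0]. *)
have [E E0 hE] := horner_dist0 (A.[0] *: B - B.[0] *: A).
exists (E / (e * `|A.[0]|)); first by rewrite divr_ge0// mulr_ge0// ltW.
exists T0 => // t tT; have eA := hT t tT; move: tT => /andP[t0 tT].
have At : A.[t] != 0 by rewrite -normr_gt0 (lt_le_trans e0).
have -> : B.[t] / A.[t] - B.[0] / A.[0] =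
    (A.[0] *: B - B.[0] *: A).[t] / (A.[t] * A.[0]).
  by rewrite !hornerE; field; rewrite At A0.
have := hE t; rewrite gtr0_norm// (le_trans (ltW tT) (ltW T01)) => /(_ isT).
have -> : (A.[0] *: B - B.[0] *: A).[0] = 0 by rewrite !hornerE mulrC subrr.
rewrite subr0 => h; rewrite normf_div normrM mulrAC.
apply: ler_pM; rewrite ?invr_ge0 ?mulr_ge0//.
by rewrite lef_pV2 ?posrE ?mulr_gt0 ?normr_gt0// ler_wpM2r.
Qed.

End Univariate.

(** * Homogeneous parts and restrictions to rays and lines *)

Section Multivariate.
Import -(notations) mpoly.
Context {C : numClosedFieldType} {d : nat}.
Implicit Types (p q : mpoly d C) (z w u : 'I_d -> C) (k : nat) (s t T : C).

Definition monomial_at (m : multinom d) z : C :=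
  \prod_i z i ^+ m i.

Definition hpart k p z : C :=
  \sum_(m <- msupp p | mdeg m == k) mcoeff m p * monomial_at m z.

Lemma monomial_atZ m z t :
  monomial_at m (fun i => t * z i) = t ^+ mdeg m * monomial_at m z.
Proof.
rewrite /monomial_at mdegE -prodrXr -big_split /=.
by apply: eq_bigr => i _; rewrite exprMn.
Qed.

Lemma meval_sum p z :
  meval z p = \sum_(m <- msupp p) mcoeff m p * monomial_at m z.
Proof. exact: mevalE. Qed.

Lemma hpartZ k p z t : hpart k p (fun i => t * z i) = t ^+ k * hpart k p z.
Proof.
rewrite /hpart big_distrr /=; apply: eq_bigr => m /eqP <-.
by rewrite monomial_atZ mulrCA.
Qed.

Lemma eq_hpart k p z w : z =1 w -> hpart k p z = hpart k p w.
Proof.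
by move=> zw; apply: eq_bigr => m _; congr (_ * _); apply: eq_bigr => i _; rewrite zw.
Qed.

Lemma meval_hparts p z n : (mmeasure mdeg p <= n)%N ->
  meval z p = \sum_(k < n) hpart k p z.
Proof.
move=> pn; rewrite meval_sum /hpart (exchange_big_dep predT)//=.
rewrite big_seq [RHS]big_seq; apply: eq_bigr => m mp.
have mn := leq_trans (msize_mdeg_lt mp) pn.
by rewrite (big_pred1 (Ordinal mn))// => i; rewrite eq_sym.
Qed.

Lemma hpart_bound k p : exists2 D, 0 <= D &
  forall z T, (forall i, `|z i| <= T) -> `|hpart k p z| <= D * T ^+ k.
Proof.
exists (\sum_(m <- msupp p | mdeg m == k) `|mcoeff m p|).
  exact: sumr_ge0.
move=> z T zT; rewrite big_distrl /= (le_trans (ler_norm_sum _ _ _))//.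
apply: ler_sum => m /eqP <-; rewrite normrM ler_wpM2l//.
rewrite normr_prod mdegE -prodrXr; apply: ler_prod => i _.
rewrite normrX exprn_ge0//= lerXn2r// nnegrE.
exact: le_trans (zT i).
Qed.

(** The restriction of [p] to the ray through [z]; it turns statements on homogeneous parts into
    statements on coefficients. *)
Definition ray_poly p z : {poly C} :=
  \sum_(m <- msupp p) (mcoeff m p * monomial_at m z) *: 'X^(mdeg m).

Lemma horner_ray p z t : (ray_poly p z).[t] = meval (fun i => t * z i) p.
Proof.
rewrite meval_sum horner_sum; apply: eq_bigr => m _.
by rewrite hornerZ hornerXn monomial_atZ mulrAC mulrA.
Qed.

Lemma coef_ray p z k : (ray_poly p z)`_k = hpart k p z.
Proof.
rewrite coef_sum /hpart [RHS]big_mkcond /=; apply: eq_bigr => m _.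
by rewrite coefZ coefXn eq_sym; case: eqP => _; rewrite ?mulr1 ?mulr0.
Qed.

Lemma monomial_line m z u : exists2 A : {poly C}, (size A <= (mdeg m).+1)%N &
  forall s, A.[s] = monomial_at m (fun i => z i + s * u i).
Proof.
exists (\prod_i ((z i)%:P + u i *: 'X) ^+ m i); last first.
  move=> s; rewrite horner_prod; apply: eq_bigr => i _.
  by rewrite horner_exp !hornerE mulrC.
rewrite mdegE.
elim/big_ind2 : _ => [|A n B k' sA sB|i _]; first by rewrite size_poly1.
  rewrite (leq_trans (size_polyMleq _ _))// -subn1 leq_subLR add1n -addSn -addnS.
  by rewrite leq_add.
rewrite (leq_trans (size_poly_exp_leq _ _))// ltnS -[leqRHS]mul1n leq_mul2r.
apply/orP; right; rewrite -subn1 leq_subLR (leq_trans (size_polyD _ _))// geq_max.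
rewrite (leq_trans (size_polyC_leq1 _))//= (leq_trans (size_scale_leq _ _))//.
by rewrite size_polyX.
Qed.

(** The predicate [P] lets one construction serve both [p] and each of its homogeneous parts. *)
Lemma sum_line (P : pred (multinom d)) p z u n :
  (mmeasure mdeg p <= n)%N -> exists2 A : {poly C}, (size A <= n)%N &
  forall s, A.[s] = \sum_(m <- msupp p | P m)
     mcoeff m p * monomial_at m (fun i => z i + s * u i).
Proof.
move=> pn.
have : all (fun m => (mdeg m < n)%N) (msupp p).
  by apply/allP => m /msize_mdeg_lt /leq_trans; apply.
elim: (msupp p) => [_|m ms IH /= /andP[mn /IH[A sA hA]]].
  by exists 0 => [|s]; rewrite ?size_poly0 // big_nil horner0.
have [B sB hB] := monomial_line m z u.
exists (if P m then mcoeff m p *: B + A else A) => [|s].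
  case: ifP => // _; rewrite (leq_trans (size_polyD _ _))// geq_max sA andbT.
  by rewrite (leq_trans (size_scale_leq _ _))// (leq_trans sB).
by rewrite big_cons; case: ifP => _; rewrite ?hornerE hA ?hB.
Qed.

(** The successor matches the size bound [n.+1] of [norm_horner1_le]. *)
Lemma meval_line p z u : exists2 A : {poly C}, (size A <= (mmeasure mdeg p).+1)%N &
  forall s, A.[s] = meval (fun i => z i + s * u i) p.
Proof.
have [A sA hA] := @sum_line xpredT p z u _ (leqnSn _).
by exists A => // s; rewrite hA meval_sum.
Qed.

Lemma hpart_line k p z u : exists A : {poly C},
  forall s, A.[s] = hpart k p (fun i => z i + s * u i).
Proof.
by have [A _ hA] := @sum_line (fun m => mdeg m == k) p z u _ (leqnn _); exists A.
Qed.

End Multivariate.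

(** * Harnack inequality and lowest homogeneous part of a stable polynomial *)

Section Stable.
Import -(notations) mpoly.
Context {C : numClosedFieldType} {d : nat}.
Implicit Types (p q : mpoly d C) (z w u : 'I_d -> C) (s t T K L : C).

Definition in_half_space z := forall i, 0 < 'Im (z i).

Definition stable p := forall z, in_half_space z -> meval z p != 0.

Lemma Im_ge_normN (x : C) : - `|x| <= 'Im x.
Proof.
rewrite lerNl -ReMil (le_trans (leif_Re_Creal _))//.
by rewrite normrM normCi mul1r.
Qed.

Lemma in_half_spaceZ t z : 0 < t -> in_half_space z -> in_half_space (fun i => t * z i).
Proof. by move=> t0 hz i; rewrite ImMl ?gtr0_real// mulr_gt0. Qed.

Lemma in_half_space_i w : (forall i, 0 < w i) -> in_half_space (fun i => 'i * w i).
Proof. by move=> w0 i; rewrite ImMil (Creal_ReP _ _) ?gtr0_real. Qed.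

(** For [|s| * L < 1] the point [z + s (w - z)] stays in the half space, so [p] on this line has no
    root in that disk; [norm_horner1_le] compares [s = 1] with [s = 0]. The point [w] may lie
    outside the half space. *)
Lemma stable_harnack p z w L : stable p -> 0 < L -> in_half_space z ->
  (forall i, `|w i - z i| <= L * 'Im (z i)) ->
  `|meval w p| <= (1 + L) ^+ mmeasure mdeg p * `|meval z p|.
Proof.
move=> ps L0 hz hwz; have [A sA hA] := meval_line p z (fun i => w i - z i).
have -> : meval w p = A.[1].
  by rewrite hA; apply: meval_eq => i; rewrite mul1r subrKC.
have -> : meval z p = A.[0].
  by rewrite hA; apply: meval_eq => i; rewrite mul0r addr0.
apply: norm_horner1_le => // s sL; rewrite hA; apply: ps => i.
rewrite raddfD /= -[X in _ < _ + X]opprK subr_gt0.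
apply: (@le_lt_trans _ _ (`|s| * L * 'Im (z i))); last first.
  by rewrite -[ltRHS]mul1r ltr_pM2r.
rewrite lerNl (le_trans _ (Im_ge_normN _))// lerN2 normrM -mulrA.
by rewrite ler_wpM2l.
Qed.

Lemma stable_comparison p z w : stable p -> in_half_space z ->
  exists2 D, 0 <= D & forall r, 0 < r ->
    `|meval (fun i => r * w i) p| <= D * `|meval (fun i => r * z i) p|.
Proof.
(* [L] dominates all these ratios; they do not change when [z] and [w] are scaled by [r], so the
   constant is uniform in [r]. *)
move=> ps hz; pose L := 1 + \sum_i `|w i - z i| / 'Im (z i).
have S0 i : 0 <= `|w i - z i| / 'Im (z i) by rewrite divr_ge0// ltW.
have L0 : 0 < L by rewrite ltr_wpDr// sumr_ge0.
exists ((1 + L) ^+ mmeasure mdeg p); first by rewrite exprn_ge0// addr_ge0// ltW.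
move=> r r0; apply: stable_harnack => // [|i]; first exact: in_half_spaceZ.
rewrite -mulrBr normrM gtr0_norm// ImMl ?gtr0_real// mulrCA ler_pM2l//.
rewrite -ler_pdivrMr// /L (bigD1 i)//= addrCA lerDl.
by rewrite addr_ge0// sumr_ge0.
Qed.

(** [M] is the order of [p] at [0] on the ray through [(i, ..., i)]. Comparison with this ray
    carries the vanishing below [M] to every [w], and the reverse comparison carries the
    nonvanishing in degree [M] to the half space. *)
Lemma stable_order p : stable p -> exists M,
  (forall k w, (k < M)%N -> hpart k p w = 0) /\
  (forall z, in_half_space z -> hpart M p z != 0).
Proof.
move=> ps; pose z0 (_ : 'I_d) : C := 'i.
have hz0 : in_half_space z0 by move=> i; rewrite Im_i.
have ray_neq0 : ray_poly p z0 != 0.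
  apply: contraTneq (ps _ hz0) => r0; rewrite negbK.
  rewrite (@meval_eq _ _ _ (fun i => 1 * z0 i)) => [|i]; last by rewrite mul1r.
  by rewrite -horner_ray r0 horner0.
have exM : exists k, (ray_poly p z0)`_k != 0.
  by exists (size (ray_poly p z0)).-1; rewrite -lead_coefE lead_coef_eq0.
case: (ex_minnP exM) => M M0 minM; exists M.
have low j : (j < M)%N -> (ray_poly p z0)`_j = 0.
  by move=> jM; apply/eqP; apply: contraTT jM => /minM; rewrite -leqNgt.
have lowp k w : (k < M)%N -> hpart k p w = 0.
  have [D D0 hD] := stable_comparison w ps hz0.
  rewrite -coef_ray; apply: (proj1 (coef_le_of_norm_le D0 low _)) => t /andP[t0 _].
  by rewrite !horner_ray hD.
split=> // z hz; have [D D0 hD] := stable_comparison z0 ps hz.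
have lowz j : (j < M)%N -> (ray_poly p z)`_j = 0 by rewrite coef_ray; apply: lowp.
apply: contraNneq M0 => hp0; rewrite -normr_le0.
have [|_] := coef_le_of_norm_le (A := ray_poly p z0) D0 lowz.
  by move=> t /andP[t0 _]; rewrite !horner_ray hD.
by rewrite (coef_ray p z) hp0 normr0 mulr0.
Qed.

(** Points of the line are given up to pointwise equality, which avoids functional
    extensionality. *)
Definition polynomial_on_lines (F : ('I_d -> C) -> C) := forall z u,
  exists A : {poly C}, forall s w, (forall i, w i = z i + s * u i) -> F w = A.[s].

Lemma hpart_polynomial_on_lines k p : polynomial_on_lines (hpart k p).
Proof.
move=> z u; have [A hA] := hpart_line k p z u; exists A => s w ws.
by rewrite hA; apply: eq_hpart.
Qed.

(** An identity theorem in two steps along lines: from positive to real vectors, then from real to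
    complex ones. *)
Lemma eq0_of_positive F : polynomial_on_lines F ->
  (forall w, (forall i, 0 < w i) -> F w = 0) -> forall w, F w = 0.
Proof.
move=> Fl Fp.
have Freal x : (forall i, x i \is Num.real) -> F x = 0.
  (* [N] exceeds every [|x i - 1|], so the line from [(1, ..., 1)] is positive for parameters in
     [(0, 1)]; it reaches [x] at parameter [N]. *)
  move=> xr; pose N : C := 1 + \sum_i `|x i - 1|.
  have N0 : 0 < N by rewrite ltr_wpDr// sumr_ge0.
  have [A hA] := Fl (fun=> 1) (fun i => (x i - 1) / N).
  rewrite (hA N) => [|i]; last by rewrite mulrC divfK ?subrKC// gt_eqF.
  suff -> : A = 0 by rewrite horner0.
  apply: poly_eq0_of_unit_interval => t /andP[t0 t1].
  rewrite -(hA t (fun i => 1 + t * ((x i - 1) / N)))//; apply: Fp => i.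
  have yr : t * ((x i - 1) / N) \is Num.real.
    apply: realM; first exact: gtr0_real.
    by apply: realM; [exact: realB|rewrite realV gtr0_real].
  rewrite -ltrBlDl sub0r ltrNl.
  apply: le_lt_trans (real_ler_norm _) _; first by rewrite rpredN.
  rewrite normrN !normrM normfV (gtr0_norm t0) (gtr0_norm N0) mulrA ltr_pdivrMr// mul1r.
  apply: (@le_lt_trans _ _ `|x i - 1|); first by rewrite ler_piMl// ltW.
  by rewrite /N (bigD1 i)//= addrCA ltrDl ltr_wpDr// sumr_ge0.
(* This line is real at real parameters and passes through [w] at parameter ['i]. *)
move=> w; have [A hA] := Fl (fun i => 'Re (w i)) (fun i => 'Im (w i)).
rewrite (hA 'i) => [|i]; last exact: Crect.
suff -> : A = 0 by rewrite horner0.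
apply: poly_eq0_of_unit_interval => t /andP[t0 t1].
rewrite -(hA t (fun i => 'Re (w i) + t * 'Im (w i)))//; apply: Freal => i.
apply: realD; first exact: Creal_Re.
by apply: realM; [exact: gtr0_real|exact: Creal_Im].
Qed.

End Stable.

(** * Expansion of the bounded quotient at the origin *)

Section Expansion.
Import -(notations) mpoly.
Context {C : numClosedFieldType} {d : nat}.
Variables (p q : mpoly d C) (K : C).
Hypotheses (ps : stable p) (K0 : 0 <= K).
Hypothesis pq : forall z, in_half_space z -> `|meval z q| <= K * `|meval z p|.
Implicit Types (z w u : 'I_d -> C) (s t T : C).

Lemma hpart_dominated M : (forall k w, (k < M)%N -> hpart k p w = 0) ->
  (forall k w, (k < M)%N -> hpart k q w = 0) /\
  forall z, in_half_space z -> `|hpart M q z| <= K * `|hpart M p z|.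
Proof.
move=> lowp.
have main z : in_half_space z -> (forall j, (j < M)%N -> (ray_poly q z)`_j = 0) /\
    `|(ray_poly q z)`_M| <= K * `|(ray_poly p z)`_M|.
  move=> hz; apply: coef_le_of_norm_le => // [j jM|t /andP[t0 _]].
    by rewrite coef_ray lowp.
  by rewrite !horner_ray; apply: pq; apply: in_half_spaceZ.
split=> [k w kM|z hz]; last by have [_] := main _ hz; rewrite !coef_ray.
(* For positive [w] the vector ['i * w] lies in the half space, and homogeneity removes the factor
   ['i ^+ k]. *)
apply: (eq0_of_positive (hpart_polynomial_on_lines k q)) => {}w w0.
have [/(_ _ kM)] := main _ (in_half_space_i w0).
rewrite coef_ray hpartZ => /eqP; rewrite mulf_eq0 expf_eq0 (negPf (neq0Ci _)) andbF /=.
by move=> /eqP.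
Qed.

(* For non-real [s], some [x] puts both [x * (1 - s)] and [x * s] in the upper
   half plane, so the domination holds, up to the factor [x ^+ M], at every
   non-real point of the complex line through the positive vectors [w] and
   [w']; hence the two restrictions to this line are proportional. *)
Lemma hpart_ratio_positive M w w' :
  (forall z, in_half_space z -> `|hpart M q z| <= K * `|hpart M p z|) ->
  (forall i, 0 < w i) -> (forall i, 0 < w' i) ->
  exists c, hpart M q w = c * hpart M p w /\ hpart M q w' = c * hpart M p w'.
Proof.
move=> dom w0 w0'; pose u i := w' i - w i.
have [A hA] := hpart_line M q w u; have [B hB] := hpart_line M p w u.
have nonreal s : 'Im s != 0 -> `|A.[s]| <= K * `|B.[s]|.
  (* Solved from [Im x = 2] and [Im (x * s) = 1], so that [Im (x * (1 - s)) = 1] too. *)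
  move=> s0; pose x := (1 - 2%:R * 'Re s) / 'Im s + 'i * 2%:R.
  have xr : (1 - 2%:R * 'Re s) / 'Im s \is Num.real.
    by rewrite realM ?realV ?Creal_Im// realB// realM ?Creal_Re// realn.
  have Imx : 'Im x = 2%:R by rewrite /x Im_rect ?realn.
  have Imxs : 'Im (x * s) = 1.
    by rewrite ImM Imx /x Re_rect ?realn// divfK// [_ * 2%:R]mulrC subrK.
  have x0 : x != 0 by apply: contra_eq_neq Imx => ->; rewrite raddf0 eq_sym pnatr_eq0.
  have n0 : 0 < `|x ^+ M| by rewrite normr_gt0 expf_neq0.
  rewrite hA hB -(ler_pM2l n0) mulrCA -!normrM -!hpartZ; apply: dom => i.
  have -> : x * (w i + s * u i) = w i * (x - x * s) + w' i * (x * s).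
    by rewrite /u; ring.
  rewrite raddfD /= (ImMl (gtr0_real (w0 i))) (ImMl (gtr0_real (w0' i))).
  rewrite raddfB /= Imx Imxs mulr1.
  by rewrite (_ : 2%:R - 1 = 1) ?mulr1 ?addr_gt0// -[2%:R]/(1 + 1) addrK.
have dominated s : `|A.[s]| <= K * `|B.[s]|.
  have [s0|/nonreal//] := eqVneq ('Im s) 0.
  (* A real [s] is the limit of the non-real points [s + 'i * t]. *)
  apply: (@norm_horner_le _ _ _ _ s 'i) => // t /andP[t0 _]; apply: nonreal.
  by rewrite raddfD /= s0 add0r ImMil (Creal_ReP _ _) ?gtr0_real// gt_eqF.
have [c AB] := colinear_of_norm_le K0 dominated; exists c.
have Ec s : hpart M q (fun i => w i + s * u i) = c * hpart M p (fun i => w i + s * u i).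
  by rewrite -hA -hB AB hornerZ.
split; [move: (Ec 0)|move: (Ec 1)].
  by rewrite !(@eq_hpart _ _ _ _ (fun i => w i + 0 * u i) w)// => i; rewrite mul0r addr0.
by rewrite !(@eq_hpart _ _ _ _ (fun i => w i + 1 * u i) w')// => i; rewrite mul1r subrKC.
Qed.

Lemma leading_part : exists M c,
  [/\ forall k w, (k < M)%N -> hpart k p w = 0,
      forall z, in_half_space z -> hpart M p z != 0 &
      forall k w, (k <= M)%N -> hpart k q w = c * hpart k p w].
Proof.
have [M [lowp Mp]] := stable_order ps; have [lowq dom] := hpart_dominated lowp.
pose e (_ : 'I_d) : C := 1.
have e0 i : 0 < e i by exact: ltr01.
have pe0 w : (forall i, 0 < w i) -> hpart M p w != 0.
  by move=> /in_half_space_i/Mp; rewrite hpartZ mulf_eq0 negb_or => /andP[].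
(* The constant is read off at [(1, ..., 1)]; every positive vector has the same ratio, and
   [eq0_of_positive] extends the identity. *)
exists M, (hpart M q e / hpart M p e); split=> // k w.
rewrite leq_eqVlt => /predU1P[->|kM]; last by rewrite (lowp _ _ kM) lowq// mulr0.
apply/eqP; rewrite -subr_eq0; apply/eqP; move: w.
apply: (@eq0_of_positive _ _ (fun w => hpart M q w - _ * hpart M p w)) => [z u|w w0].
  have [A hA] := hpart_polynomial_on_lines M q z u.
  have [B hB] := hpart_polynomial_on_lines M p z u.
  exists (A - (hpart M q e / hpart M p e) *: B) => s w ws.
  by rewrite (hA _ _ ws) (hB _ _ ws) !hornerE.
have [c [-> ->]] := hpart_ratio_positive dom w0 e0.
by rewrite mulfK ?pe0// subrr.
Qed.

(** Terms up to degree [M] cancel, and those of degree [n > M] are [O(T ^+ n)], hence [O(T ^+ M.+1)]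
    since [T <= 1]. *)
Lemma hparts_tail_bound M c k0 : (forall k w, (k <= M)%N -> hpart k q w = c * hpart k p w) ->
  1 <= k0 -> forall n, exists2 D, 0 <= D & forall z T, 0 < T <= 1 ->
    (forall i, `|z i| <= k0 * T) ->
    `|\sum_(k < n) (hpart k q z - c * hpart k p z)| <= D * T ^+ M.+1.
Proof.
move=> cM k01; have k00 : 0 <= k0 by rewrite (le_trans ler01).
elim=> [|n [D D0 hD]].
  by exists 0 => // z T _ _; rewrite big_ord0 normr0 mul0r.
have [nM|Mn] := leqP n M.
  exists D => // z T T1 zT; rewrite big_ord_recr /= cM// subrr addr0.
  exact: hD.
have [E E0 hE] := hpart_bound n q; have [F F0 hF] := hpart_bound n p.
exists (D + (E + `|c| * F) * k0 ^+ n).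
  by rewrite addr_ge0// mulr_ge0 ?exprn_ge0// addr_ge0// mulr_ge0.
move=> z T /andP[T0 T1] zT; rewrite big_ord_recr /= mulrDl.
rewrite (le_trans (ler_normD _ _))// lerD ?hD ?T0//.
apply: (@le_trans _ _ ((E + `|c| * F) * (k0 * T) ^+ n)).
  rewrite (le_trans (ler_normB _ _))// mulrDl lerD ?hE// normrM -mulrA.
  by rewrite ler_wpM2l// hF.
rewrite exprMn mulrA ler_wpM2l//; first by rewrite mulr_ge0 ?exprn_ge0// addr_ge0// mulr_ge0.
by rewrite ler_wiXn2l// ltW.
Qed.

(** Limits are expressed by explicit bounds, as [C] is an abstract field. [T] is a scale to which
    all moduli and heights of [z] are comparable. *)
Lemma nontangential_expansion : exists c : C,
  (forall k0, 1 <= k0 -> exists2 D, 0 <= D & exists2 T0, 0 < T0 &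
     forall z T, 0 < T < T0 ->
       (forall i, `|z i| <= k0 * T /\ T <= k0 * 'Im (z i)) ->
       `|meval z q / meval z p - c| <= D * T) /\
  (forall v, in_half_space v -> exists l D T0, [/\ 0 <= D, 0 < T0 &
     forall t, 0 < t < T0 ->
     `|(meval (fun i => t * v i) q / meval (fun i => t * v i) p - c) / t - l| <= D * t]).
Proof.
have [M [c [lowp Mp cM]]] := leading_part; exists c.
have low_ray z j : (j < M)%N -> (ray_poly p z)`_j = 0 by rewrite coef_ray; apply: lowp.
split=> [k0 k01|v hv].
  have k0_gt0 : 0 < k0 by rewrite (lt_le_trans ltr01).
  pose n := maxn (mmeasure mdeg p) (mmeasure mdeg q).
  have [D D0 hD] := hparts_tail_bound cM k01 n.
  pose zi (_ : 'I_d) : C := 'i.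
  have hzi : in_half_space zi by move=> i; rewrite Im_i.
  have /norm_horner_lower_bound[e e0 [T0 /andP[T00 T01] he]] :
      (drop_poly M (ray_poly p zi)).[0] != 0.
    by rewrite horner0_drop coef_ray Mp.
  (* From [|T * 'i - z i| <= (1 + k0) * T] and [T <= k0 * 'Im (z i)]. *)
  pose L := (1 + k0) * k0.
  have L0 : 0 < L by rewrite mulr_gt0// addr_gt0.
  pose H := (1 + L) ^+ mmeasure mdeg p.
  have H0 : 0 < H by rewrite exprn_gt0// addr_gt0.
  exists (D * H / e); first by rewrite divr_ge0 ?mulr_ge0// ltW.
  exists T0 => // z T TT hz; have /andP[T_gt0 TT0] := TT.
  have T1 : T <= 1 by rewrite ltW// (lt_trans TT0).
  have hz0 : in_half_space z.
    by move=> i; have [_ /(lt_le_trans T_gt0)] := hz i; rewrite pmulr_rgt0.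
  have pz0 := ps hz0.
  (* Harnack against the point [T * (i, ..., i)], where [|p|] is at least [e * T ^+ M]. *)
  have lower : e * T ^+ M <= H * `|meval z p|.
    apply: (@le_trans _ _ `|meval (fun i => T * zi i) p|); last first.
      apply: stable_harnack => // i; have [zi1 zi2] := hz i.
      rewrite (le_trans (ler_normB _ _))// normrM normCi mulr1 gtr0_norm// /L -mulrA.
      rewrite (le_trans _ (ler_wpM2l _ zi2)) ?addr_ge0 ?(ltW k0_gt0)//.
      by rewrite mulrDl mul1r lerD2l.
    rewrite -horner_ray {1}(low_coef0_drop (low_ray zi)) hornerM hornerXn normrM.
    by rewrite normrX (gtr0_norm T_gt0) ler_wpM2r ?exprn_ge0 ?(ltW T_gt0)// he.
  have -> : meval z q / meval z p - c = (meval z q - c * meval z p) / meval z p.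
    by rewrite mulrBl mulfK.
  have -> : meval z q - c * meval z p = \sum_(k < n) (hpart k q z - c * hpart k p z).
    rewrite (@meval_hparts _ _ q z n) ?leq_maxr// (@meval_hparts _ _ p z n) ?leq_maxl//.
    by rewrite sumrB mulr_sumr.
  rewrite normf_div ler_pdivrMr ?normr_gt0//.
  apply: le_trans (hD z T _ _) _; first by rewrite T_gt0.
    by move=> i; have [] := hz i.
  have := ler_wpM2l (divr_ge0 (mulr_ge0 D0 (ltW T_gt0)) (ltW e0)) lower.
  rewrite mulrA divfK ?gt_eqF// -mulrA -exprS => /le_trans; apply.
  by rewrite (_ : _ / e * _ = D * H / e * T * `|meval z p|)//; ring.
(* On the ray, [q - c p] is [B * t ^+ M.+1] and [p] is [A * t ^+ M], so the difference quotient is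
   [B / A] with [A(0) != 0]. *)
pose G := ray_poly q v - c *: ray_poly p v.
have EG : G = drop_poly M.+1 G * 'X^(M.+1).
  by apply: low_coef0_drop => j jM; rewrite coefB coefZ !coef_ray cM// subrr.
have Ep := low_coef0_drop (low_ray v).
set A := drop_poly M (ray_poly p v) in Ep; set B := drop_poly M.+1 G in EG.
have A0 : A.[0] != 0 by rewrite horner0_drop coef_ray Mp.
have [D D0 [T0 T00 hD]] := horner_ratio_lipschitz B A0.
exists (B.[0] / A.[0]), D, T0; split=> // t tT; have /andP[t0 _] := tT.
suff -> : (meval (fun i => t * v i) q / meval (fun i => t * v i) p - c) / t = B.[t] / A.[t].
  exact: hD.
have pt0 := ps (in_half_spaceZ t0 hv); move: pt0; rewrite -!horner_ray => pt0.
have Eq : (ray_poly q v).[t] = B.[t] * t ^+ M.+1 + c * (ray_poly p v).[t].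
  by rewrite -hornerXn -hornerM -EG !hornerE subrK.
have t_neq0 : t != 0 by rewrite gt_eqF.
move: pt0; rewrite Eq Ep hornerM hornerXn mulf_eq0 negb_or => /andP[At0 tM].
by rewrite exprSr; field; rewrite At0 t_neq0 tM.
Qed.
End Expansion.

Local Open Scope classical_set_scope.
Local Open Scope complex_scope.

(** * From explicit bounds to limits in the complex numbers *)

Section Transfer.
Context {R : realType}.

Lemma in_half_spaceP d (z : 'rV[R[i]]_d) : upper_half_space z <-> in_half_space (z 0).
Proof. by split=> h i; move: (h i); rewrite -complexIm ltcR. Qed.

Lemma gt0_real_part (x : R[i]) : 0 < x -> exists2 r : R, 0 < r & x = r%:C.
Proof.
case: x => a b; rewrite ltcE /= => /andP[/eqP -> a0].
by exists a.
Qed.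

Lemma approach_region_scale d (z : 'rV[R[i]]_d) (k r : R) : 0 < r ->
  approach_region k z -> (forall i, `|z 0 i| < r%:C) ->
  exists2 T : R[i], 0 < T < r%:C &
    forall i, `|z 0 i| <= k%:C * T /\ T <= k%:C * 'Im (z 0 i).
Proof.
move=> r0 [zU zk] zr; case: d z zU zk zr => [|d] z zU zk zr.
  (* With [d = 0] no coordinate provides a scale; otherwise [T] is the modulus of the first one. *)
  exists (r / 2%:R)%:C => [|[]//].
  by rewrite !ltcR divr_gt0//= ltr_pdivrMr// mulr_natr mulr2n ltrDl.
have normE i : `|z 0 i| = (ComplexField.Normc.normc (z 0 i))%:C by [].
have n0 i : 0 < ComplexField.Normc.normc (z 0 i).
  rewrite -ltcR -normE normr_gt0; apply: contraTneq (zU i) => ->.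
  by rewrite ltxx.
exists `|z 0 ord0|; first by rewrite zr andbT normE ltcR.
move=> i; rewrite -complexIm !normE -!rmorphM !lecR; split.
  have /andP[_] := zk _ _ (ex_intro _ i (or_introl erefl)) (ex_intro _ ord0 (or_introl erefl)).
  by rewrite ler_pdivrMr.
have /andP[_] := zk _ _ (ex_intro _ ord0 (or_introl erefl)) (ex_intro _ i (or_intror erefl)).
by rewrite ler_pdivrMr// zU.
Qed.

Lemma is_nt_limit_of_bound d (f : 'rV[R[i]]_d -> R[i]) (c : R[i]) :
  (forall k0 : R[i], 1 <= k0 -> exists2 D : R[i], 0 <= D & exists2 T0 : R[i], 0 < T0 &
     forall (z : 'rV[R[i]]_d) (T : R[i]), 0 < T < T0 ->
       (forall i, `|z 0 i| <= k0 * T /\ T <= k0 * 'Im (z 0 i)) ->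
       `|f z - c| <= D * T) ->
  is_nt_limit f c.
Proof.
move=> exp k k1; have k1C : (1 : R[i]) <= k%:C by rewrite -[1]/(1%:C) lecR.
have [D D0 [T0 T00 hT]] := exp _ k1C.
apply/cvgrPdist_le => e e0.
(* [D + 1] stays invertible when [D = 0]. *)
have D1 : 0 < D + 1 by rewrite ltr_wpDl.
have e'0 : 0 < e / (D + 1) by rewrite divr_gt0.
have [r1 r10 Er1] := gt0_real_part T00; have [r2 r20 Er2] := gt0_real_part e'0.
pose r := Num.min r1 r2; have r0 : 0 < r by rewrite lt_min r10.
have rT0 : r%:C <= T0 by rewrite Er1 lecR ge_min lexx.
have re : r%:C <= e / (D + 1) by rewrite Er2 lecR ge_min lexx orbT.
apply/nbhs_ballP; exists r%:C; first by rewrite /= ltcR.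
move=> z [_ zr] kz; have [i|T /andP[T_gt0 Tr] zT] := approach_region_scale r0 kz.
  by have := zr 0 i; rewrite mxE -ball_normE /ball_ /= sub0r normrN.
rewrite distrC; apply: le_trans (hT _ T _ zT) _.
  by rewrite T_gt0 (lt_le_trans Tr).
have := le_trans (ltW Tr) re; rewrite ler_pdivlMr// => /(le_trans _); apply.
by rewrite mulrC ler_wpM2l ?(ltW T_gt0)// lerDl.
Qed.

Lemma cvg_at_right_of_bound (g : R -> R[i]) (l D T0 : R[i]) : 0 <= D -> 0 < T0 ->
  (forall t : R, 0 < t -> t%:C < T0 -> `|g t - l| <= D * t%:C) ->
  g t @[t --> (0 : R)^'+] --> l.
Proof.
move=> D0 T00 h; apply/cvgrPdist_le => e e0.
have D1 : 0 < D + 1 by rewrite ltr_wpDl.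
have e'0 : 0 < e / (D + 1) by rewrite divr_gt0.
have [r1 r10 Er1] := gt0_real_part T00; have [r2 r20 Er2] := gt0_real_part e'0.
near=> t; have t0 : 0 < t by [].
rewrite distrC; apply: le_trans (h t t0 _) _.
  by rewrite Er1 ltcR; near: t; exact: nbhs_right_lt.
have : t%:C <= e / (D + 1).
  by rewrite Er2 lecR; near: t; exact: nbhs_right_le.
rewrite ler_pdivlMr// => /(le_trans _); apply.
by rewrite mulrC ler_wpM2l ?lecR ?(ltW t0)// lerDl.
Unshelve. all: by end_near. Qed.

End Transfer.

Theorem theorem3p5 (R : realType) (d : nat) (p q : mpoly.mpoly d R[i])
    (p_nonzero : forall z : 'rV[R[i]]_d,
       upper_half_space z -> mpoly.meval (z 0) p != 0)
    (f_bounded : exists M : R, forall z : 'rV[R[i]]_d,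
       upper_half_space z -> `|ratfun q p z| <= M%:C) :
  forall v : 'rV[R[i]]_d, upper_half_space v ->
    cvg ((ratfun q p (r%:C *: v) - nt_lim (ratfun q p)) / r%:C @[r --> (0 : R)^'+]).
Proof.
move=> v hv; have [M hM] := f_bounded.
have mevalE (z : 'I_d -> R[i]) (s : mpoly.mpoly d R[i]) :
    mpoly.meval ((\row_j z j) 0) s = mpoly.meval z s.
  by apply: mpoly.meval_eq => i; rewrite mxE.
have rowP (z : 'I_d -> R[i]) : in_half_space z -> upper_half_space (\row_j z j).
  by move=> hz; apply/in_half_spaceP => i; rewrite mxE.
have ps : stable p.
  by move=> z /rowP/p_nonzero; rewrite mevalE.
(* The modulus of [M] supplies a nonnegative constant. *)
have dom z : in_half_space z -> `|mpoly.meval z q| <= `|M%:C| * `|mpoly.meval z p|.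
  move=> hz; have pz : 0 < `|mpoly.meval z p| by rewrite normr_gt0 ps.
  rewrite -ler_pdivrMr// -normf_div -(mevalE z p) -(mevalE z q).
  rewrite (le_trans (hM _ (rowP _ hz)))//.
  by rewrite real_ler_norm// complex_real.
have [c [hnt hder]] := nontangential_expansion ps (normr_ge0 _) dom.
(* Uniqueness of the limit identifies the value of [nt_lim] with [c]. *)
have /nt_limE -> : is_nt_limit (ratfun q p) c.
  apply: is_nt_limit_of_bound => k0 /hnt[D D0 [T0 T00 hT]].
  by exists D => //; exists T0 => // z T; apply: hT.
have [l [D [T0 [D0 T00 hl]]]] := hder _ (proj1 (in_half_spaceP v) hv).
apply/cvg_ex; exists l; apply: (cvg_at_right_of_bound D0 T00) => t t0 tT.
have := hl t%:C; rewrite ltcR t0 tT => /(_ isT).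
have scaleE (s : mpoly.mpoly d R[i]) : mpoly.meval ((t%:C *: v) 0) s =
    mpoly.meval (fun i => t%:C * v 0 i) s.
  by apply: mpoly.meval_eq => i; rewrite mxE.
by rewrite /ratfun !scaleE.
Qed.
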